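(* Let $m_1,m_2,m_3>0$. Let $x=(x_1,x_2,x_3):\mathbb{R}\to(\mathbb{R}^2)^3$ be a solution of the Newtonian three-body problem with masses $m_1,m_2,m_3$ (binary collisions being allowed and continued by Levi-Civita regularization) which has zero angular momentum, has no triple collisions, and is bounded. Then $x$ suffers infinitely many eclipses; that is, the set of times $t$ at which the three points $x_1(t),x_2(t),x_3(t)$ are collinear is infinite.
   Context: Newtonian three-body problem: point masses $m_i>0$ at positions $x_i\in\mathbb{R}^2$, $r_{ij}=|x_i-x_j|$, $U=\sum_{i<j}m_im_j/r_{ij}$; Newton's equations are $m_i\ddot x_i=\partial U/\partial x_i$, $i=1,2,3$. Angular momentum: $J=\sum_i m_i (x_i-x_c)\wedge(\dot x_i-\dot x_c)$, where $x_c=\sum_i m_ix_i/\sum_i m_i$ is the center of mass and $(a_1,a_2)\wedge(b_1,b_2)=a_1b_2-a_2b_1$. Zero angular momentum means $J=0$. A triple collision at time $t$ means $x_1(t)=x_2(t)=x_3(t)$. A binary collision at time $t$ means that exactly two of the $x_i(t)$ coincide. Solutions: a solution without triple collision is a continuous curve $x:\mathbb{R}\to(\mathbb{R}^2)^3$ with no triple collision, satisfying Newton's equations at all non-collision times, whose set of binary collision times is discrete, and which at each binary collision time $t_c$ is continued by Levi-Civita regularization, i.e. near $t_c$ the positions $x_i(t)$ are real-analytic functions of $(t-t_c)^{1/3}$ (the analytic continuation of the solution through the collision in regularized time). A solution without triple collision can be continued in this way for all time. Bounded: there is a constant $C$ with $r_{ij}(t)\le C$ for all $i,j$ and all $t$.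 Eclipse: the solution suffers an eclipse at time $t$ when $x_1(t),x_2(t),x_3(t)$ lie on a line. A binary collision counts as an eclipse. *)

(* Defs.v *)
From Stdlib Require Import Reals Lra List.
From Coquelicot Require Import Coquelicot.
Open Scope R_scope.

Definition point : Type := (R * R)%type.

Inductive body : Type := body1 | body2 | body3.

Definition body_eq_dec (i j : body) : {i = j} + {i <> j}.
Proof. decide equality. Defined.

Definition configuration : Type := body -> point.

Definition sum3 (f : body -> R) : R := f body1 + f body2 + f body3.

Definition wedge (a b : point) : R := fst a * snd b - snd a * fst b.

Definition mutual_distance (q : configuration) (i j : body) : R :=
  dist_euc (fst (q i)) (snd (q i)) (fst (q j)) (snd (q j)).

(** The negative of the potential energy, with [G = 1].  At a collision
    configuration the value is meaningless. *)
Definition newton_U (m : body -> R) (q : configuration) : R :=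
  m body1 * m body2 / mutual_distance q body1 body2
  + m body1 * m body3 / mutual_distance q body1 body3
  + m body2 * m body3 / mutual_distance q body2 body3.

Definition move (q : configuration) (i : body) (p : point) : configuration :=
  fun j => if body_eq_dec i j then p else q j.

(** [grad f q i] is [∂f/∂x_i], the pair of partial derivatives of [f] in the two
    coordinates of the [i]-th point. *)
Definition grad (f : configuration -> R) (q : configuration) (i : body) : point :=
  (Derive (fun a => f (move q i (a, snd (q i)))) (fst (q i)),
   Derive (fun b => f (move q i (fst (q i), b))) (snd (q i))).

(** [velocity] is total, as [Derive] is; it is the derivative only where
    [differentiable] holds. *)
Definition velocity (c : R -> point) (t : R) : point :=
  (Derive (fun s => fst (c s)) t, Derive (fun s => snd (c s)) t).

Definition differentiable (c : R -> point) (t : R) : Prop :=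
  ex_derive (fun s => fst (c s)) t /\ ex_derive (fun s => snd (c s)) t.

Definition collision (q : configuration) : Prop :=
  exists i j, i <> j /\ q i = q j.

Definition triple_collision (q : configuration) : Prop :=
  q body1 = q body2 /\ q body2 = q body3.

Definition binary_collision (q : configuration) : Prop :=
  collision q /\ ~ triple_collision q.

Definition eclipse (q : configuration) : Prop :=
  exists a b c : R, (a, b) <> (0, 0) /\
    forall i, a * fst (q i) + b * snd (q i) = c.

(** For a continuous [x] the set of non-collision times is open, so requiring
    this at all of them makes [x] twice differentiable there in the usual
    sense. *)
Definition newton_at (m : body -> R) (x : R -> configuration) (t : R) : Prop :=
  forall i,
    differentiable (fun s => x s i) t /\
    differentiable (velocity (fun s => x s i)) t /\
    scal (m i) (velocity (velocity (fun s => x s i)) t) = grad (newton_U m) (x t) i.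

Definition analytic_at (f : R -> R) (s0 : R) : Prop :=
  exists a : nat -> R, locally s0 (fun s => is_pseries a (s - s0) (f s)).

Definition discrete_set (S : R -> Prop) : Prop :=
  forall t, S t -> exists d : posreal, forall s, S s -> Rabs (s - t) < d -> s = t.

(** Near [tc], each coordinate is a real-analytic function of the real cube root
    [s = (t - tc)^(1/3)], i.e. it is analytic in [s] after putting
    [t = tc + s^3]; both signs of [s] are covered, so a single power series
    describes the motion before and after the collision. *)
Definition levi_civita_at (x : R -> configuration) (tc : R) : Prop :=
  forall i,
    analytic_at (fun s => fst (x (tc + s ^ 3) i)) 0 /\
    analytic_at (fun s => snd (x (tc + s ^ 3) i)) 0.

Record solution_without_triple_collision
    (m : body -> R) (x : R -> configuration) : Prop := {
  sol_continuous : forall i t, continuous (fun s => x s i) t;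
  sol_no_triple : forall t, ~ triple_collision (x t);
  sol_newton : forall t, ~ collision (x t) -> newton_at m x t;
  sol_discrete : discrete_set (fun t => binary_collision (x t));
  sol_levi_civita : forall t, binary_collision (x t) -> levi_civita_at x t
}.

Definition center_of_mass (m : body -> R) (q : configuration) : point :=
  (sum3 (fun i => m i * fst (q i)) / sum3 m,
   sum3 (fun i => m i * snd (q i)) / sum3 m).

Definition angular_momentum (m : body -> R) (x : R -> configuration) (t : R) : R :=
  let xc := fun s => center_of_mass m (x s) in
  sum3 (fun i =>
    m i * wedge (minus (x t i) (xc t))
                (minus (velocity (fun s => x s i) t) (velocity xc t))).

(** Velocities do not exist at a collision, so only the other times count. *)
Definition zero_angular_momentum (m : body -> R) (x : R -> configuration) : Prop :=
  forall t, ~ collision (x t) -> angular_momentum m x t = 0.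

Definition bounded_motion (x : R -> configuration) : Prop :=
  exists K : R, forall i j t, mutual_distance (x t) i j <= K.

Definition infinite_set (S : R -> Prop) : Prop :=
  ~ exists l : list R, forall t, S t -> In t l.

(* Main.v *)
Require Import Defs.
From Stdlib Require Import Reals Lra List.
From Coquelicot Require Import Coquelicot.
Open Scope R_scope.

(** If there were only finitely many eclipses, the triangle would be nondegenerate
    at all times after some [T], hence free of collisions, and its oriented area
    [A] would keep its sign, say positive.  This is impossible for a bounded motion
    with zero angular momentum, by the following argument.

    Let [Q] be the sum of the squared sides, [I] the moment of inertia about the
    center of mass and [U] the negative of the potential energy.  The quantity
    [z = A / Q] depends only on the shape of the triangle and on its orientation;
    it vanishes on collinear configurations and is extremal on equilateral
    triangles.  Put [G = (A' Q - A Q') / I], so that [z' = (I / Q^2) G].  When the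
    angular momentum is zero,
        [G' = - (A / I) (c k + P)],   [c = 4 (1/m1 + 1/m2 + 1/m3)],
    where [k] is twice the kinetic energy of the change of shape and [P >= 0]
    because the longer of two sides attracts less ([derive_flux], resting on
    [shape_kinetic_identity] and [size_pull]).  Hence [G] decreases.  It cannot
    become negative, for then [z] would fall at a definite rate and vanish.  So [z]
    increases, stays above some [z0 > 0], and the shape stays away from collinear
    shapes; in particular [U sqrt I] is bounded.

    The energy [h] is negative, since [I'' = 4 h + 2 U] and a bounded [I] excludes
    [I'' >= const > 0].  Let [rho = I^(1/4)] and [v = I' / (2 rho)].  Then
        [v' = (k/2 + h) / rho],
    and [v] is bounded because [v^2 <= 2 sqrt I (h + U)].  The term in [k] is paid
    for by [G / rho], whose derivative is at most [- c z0 k / rho] up to an error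
    bounded by a multiple of [z'], and that error is paid for by [z].  So for suitable
    positive [lam] and [mu] the function [Phi = v + lam G / rho - mu z] is bounded
    below, while [Phi' <= h / rho <= h / max rho < 0] for all times, a
    contradiction ([no_bounded_shape_rise]). *)

(** * Functions with derivative bounds on a half-line *)

(** [auto_derive] leaves derivatives of eta-expanded functions behind, which
    [is_derive_unique] does not match syntactically. *)
Lemma Derive_eta (f : R -> R) (t l : R) :
  is_derive f t l -> Derive (fun s : R => f s) t = l.
Proof. exact (is_derive_unique f t l). Qed.

Lemma mean_value_bound (f f' : R -> R) (T c : R) :
  (forall t, T < t -> is_derive f t (f' t)) ->
  (forall t, T < t -> f' t <= c) ->
  forall s t, T < s -> s <= t -> f t - f s <= c * (t - s).
Proof.
  intros Hd Hc s t Hs Hst.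
  destruct (MVT_gen f s t f') as [r [Hr E]].
  - intros y Hy. apply Hd. rewrite Rmin_left in Hy; lra.
  - intros y Hy. apply derivable_continuous_pt. exists (f' y).
    apply is_derive_Reals, Hd. rewrite Rmin_left in Hy; lra.
  - rewrite Rmin_left, Rmax_right in Hr by lra. rewrite E.
    apply Rmult_le_compat_r; [lra|]. apply Hc; lra.
Qed.

Lemma bounded_below_not_decreasing_steadily (f f' : R -> R) (T c B : R) :
  0 < c ->
  (forall t, T < t -> is_derive f t (f' t)) ->
  (forall t, T < t -> f' t <= - c) ->
  (forall t, T < t -> B <= f t) -> False.
Proof.
  intros Hc Hd Hf HB.
  assert (H1 := HB (T + 1) ltac:(lra)).
  assert (0 <= (f (T + 1) - B) / c) by (apply Rdiv_le_0_compat; lra).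
  set (d := (f (T + 1) - B) / c) in *.
  assert (Ed : c * d = f (T + 1) - B) by (unfold d; field; lra).
  assert (H2 := mean_value_bound f f' T (- c) Hd Hf (T + 1) (T + 1 + (d + 1))
                  ltac:(lra) ltac:(lra)).
  assert (H3 := HB (T + 1 + (d + 1)) ltac:(lra)).
  nra.
Qed.

Lemma strongly_convex_not_bounded (f f' f'' : R -> R) (T c B : R) :
  0 < c ->
  (forall t, T < t -> is_derive f t (f' t)) ->
  (forall t, T < t -> is_derive f' t (f'' t)) ->
  (forall t, T < t -> c <= f'' t) ->
  (forall t, T < t -> f t <= B) -> False.
Proof.
  intros Hc Hd Hd' Hf HB.
  assert (Hopp : forall g g' : R -> R, (forall t, T < t -> is_derive g t (g' t)) ->
            forall t, T < t -> is_derive (fun s => - g s) t (- g' t)).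
  { intros g g' Hg t Ht. apply (is_derive_opp g), Hg, Ht. }
  assert (Hneg : forall s, T < s -> f' s < 1).
  { intros s Hs. apply Rnot_le_lt. intros H1.
    apply (bounded_below_not_decreasing_steadily (fun t => - f t) (fun t => - f' t)
             s 1 (- B)); try lra.
    - intros t Ht. apply Hopp; [exact Hd | lra].
    - intros t Ht.
      assert (H2 := mean_value_bound _ _ T 0 (Hopp _ _ Hd')).
      simpl in H2.
      assert (H3 := H2 ltac:(intros y Hy; specialize (Hf y Hy); lra) s t Hs ltac:(lra)).
      lra.
    - intros t Ht. assert (H2 := HB t ltac:(lra)). lra. }
  apply (bounded_below_not_decreasing_steadily (fun t => - f' t) (fun t => - f'' t)
           T c (- 1)); auto.
  - intros t Ht. specialize (Hf t Ht). lra.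
  - intros t Ht. specialize (Hneg t Ht). lra.
Qed.

(** The analytic core, freed from the geometry.  The functions stand for: [I] the
    moment of inertia, [D] its derivative, [U] minus the potential energy, [z] the
    shape variable, [G] its flux, [w] the positive factor in [z' = w G]; [h] is the
    energy and [k] twice the kinetic energy that is not radial.  The exponent in
    [rho = I^(1/4)] is the one for which the radial kinetic energy [D^2 / (4 I)] drops
    out of the derivative of [D / rho]; it is the scaling of McGehee's
    coordinates. *)
Lemma no_bounded_shape_rise
  (T h c wl Imax zmax u0 : R) (I D U z G w : R -> R) :
  let k := fun t => 2 * (h + U t) - D t ^ 2 / (4 * I t) in
  0 < c -> 0 < wl -> 0 < u0 ->
  (forall t, T < t -> 0 < I t <= Imax) ->
  (forall t, T < t -> u0 <= U t) ->
  (forall z0, 0 < z0 -> exists C, forall t, T < t -> z0 <= z t -> U t * sqrt (I t) <= C) ->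
  (forall t, T < t -> 0 <= k t) ->
  (forall t, T < t -> 0 < z t <= zmax) ->
  (forall t, T < t -> wl <= w t * I t) ->
  (forall t, T < t -> is_derive I t (D t)) ->
  (forall t, T < t -> is_derive D t (4 * h + 2 * U t)) ->
  (forall t, T < t -> is_derive z t (w t * G t)) ->
  (forall t, T < t -> exists G', is_derive G t G' /\ G' <= - c * k t * z t) ->
  False.
Proof.
  intros k Hc Hwl Hu0 HI HU HUI Hk Hz Hw HdI HdD Hdz HdG.
  assert (Himax : 0 < Imax) by (generalize (HI (T + 1) ltac:(lra)); lra).
  assert (Hwpos : forall t, T < t -> 0 < wl / Imax <= w t).
  { intros t Ht. destruct (HI t Ht). specialize (Hw t Ht).
    split; [apply Rdiv_lt_0_compat; lra|].
    apply Rmult_le_reg_r with Imax; [lra|].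
    unfold Rdiv. rewrite Rmult_assoc, Rinv_l, Rmult_1_r by lra.
    assert (0 < w t) by nra. nra. }
  (* By the virial identity, nonnegative energy would make [I] strictly convex. *)
  assert (Hneg : h < 0).
  { apply Rnot_le_lt. intros Hh.
    apply (strongly_convex_not_bounded I D (fun t => 4 * h + 2 * U t) T (2 * u0) Imax); auto.
    - lra.
    - intros t Ht. specialize (HU t Ht). lra.
    - intros t Ht. apply HI, Ht. }
  assert (HdG' : forall t, T < t -> is_derive G t (Derive G t) /\
                   Derive G t <= - c * k t * z t).
  { intros t Ht. destruct (HdG t Ht) as [G' [H1 H2]].
    rewrite (is_derive_unique _ _ _ H1). auto. }
  (* [G] decreases, so once negative it would drive [z] below zero. *)
  assert (HG : forall t, T < t -> 0 <= G t).
  { intros s Hs. apply Rnot_lt_le. intros Hlt.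
    apply (bounded_below_not_decreasing_steadily z (fun t => w t * G t) s
             (wl / Imax * - G s) 0).
    - destruct (Hwpos s Hs). nra.
    - intros t Ht. apply Hdz. lra.
    - intros t Ht.
      assert (H := mean_value_bound G (Derive G) T 0).
      assert (H1 : G t - G s <= 0 * (t - s)).
      { apply H; try lra.
        - intros y Hy. apply HdG', Hy.
        - intros y Hy. destruct (HdG' y Hy) as [_ H1].
          specialize (Hk y Hy). specialize (Hz y Hy).
          assert (0 <= c * k y) by nra. nra. }
      destruct (Hwpos t ltac:(lra)). nra.
    - intros t Ht. generalize (Hz t ltac:(lra)). lra. }
  set (T1 := T + 1).
  set (z0 := z T1).
  assert (Hz0 : forall t, T1 <= t -> z0 <= z t).
  { intros t Ht.
    assert (H := mean_value_bound (fun s => - z s) (fun s => - (w s * G s)) T 0).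
    assert (H1 : - z t - - z T1 <= 0 * (t - T1)).
    { apply H; unfold T1 in *; try lra.
      - intros y Hy. apply (is_derive_opp z), Hdz, Hy.
      - intros y Hy. destruct (Hwpos y Hy). specialize (HG y Hy). nra. }
    unfold z0. lra. }
  assert (Hz0pos : 0 < z0) by (unfold z0; apply Hz; unfold T1; lra).
  destruct (HUI z0 Hz0pos) as [C HC].
  set (rho := fun t => sqrt (sqrt (I t))).
  assert (Hrho : forall t, T < t -> 0 < rho t /\ rho t ^ 4 = I t /\ rho t ^ 2 = sqrt (I t)).
  { intros t Ht. destruct (HI t Ht) as [Hp _]. unfold rho.
    assert (0 < sqrt (I t)) by (apply sqrt_lt_R0; exact Hp).
    split; [apply sqrt_lt_R0; assumption|].
    replace (sqrt (sqrt (I t)) ^ 4) with ((sqrt (sqrt (I t)) ^ 2) ^ 2) by ring.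
    rewrite !pow2_sqrt by lra. auto. }
  assert (Hdrho : forall t, T < t -> is_derive rho t (D t / (4 * rho t ^ 3))).
  { intros t Ht. destruct (HI t Ht) as [Hp _]. destruct (Hrho t Ht) as [H1 [H2 H3]].
    assert (0 < sqrt (I t)) by (apply sqrt_lt_R0; exact Hp).
    unfold rho. auto_derive.
    - repeat split; auto. exists (D t). apply HdI, Ht.
    - rewrite (Derive_eta _ _ _ (HdI t Ht)). fold (rho t). rewrite <- H3.
      field. lra. }
  set (rm := sqrt (sqrt Imax)).
  assert (Hrm : forall t, T < t -> rho t <= rm).
  { intros t Ht. apply sqrt_le_1_alt, sqrt_le_1_alt, HI, Ht. }
  (* [v^2 = rho^2 D^2 / (4 I) <= 2 rho^2 (h + U)], where [h < 0] and
     [rho^2 U <= C]. *)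
  set (V := sqrt (2 * C)).
  assert (Hv : forall t, T1 <= t -> Rabs (D t / (2 * rho t)) <= V).
  { intros t Ht. assert (Ht' : T < t) by (unfold T1 in Ht; lra).
    destruct (HI t Ht') as [Hp _]. destruct (Hrho t Ht') as [H1 [H2 H3]].
    specialize (HC t Ht' (Hz0 t Ht)). specialize (Hk t Ht'). unfold k in Hk.
    rewrite <- H3 in HC. rewrite <- sqrt_Rsqr_abs. apply sqrt_le_1_alt.
    unfold Rsqr.
    assert (E : D t / (2 * rho t) * (D t / (2 * rho t)) =
                rho t ^ 2 * (D t ^ 2 / (4 * I t))).
    { rewrite <- H2. field. lra. }
    rewrite E. assert (0 < rho t ^ 2) by nra. nra. }
  assert (HV0 : 0 <= V) by apply sqrt_pos.
  (* [lam] makes the [k]-term in the derivative of [lam * G / rho] cancel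
     [k / (2 * rho)]; [mu] dominates the term that comes from the derivative of
     [1 / rho], using [G / I <= w * G / wl]. *)
  set (lam := 1 / (2 * c * z0)).
  set (mu := lam * V / wl).
  assert (Hlam : 0 < lam) by (apply Rdiv_lt_0_compat; nra).
  assert (Hmu : 0 <= mu) by (apply Rdiv_le_0_compat; nra).
  set (Phi := fun t => D t / (2 * rho t) + lam * (G t / rho t) - mu * z t).
  apply (bounded_below_not_decreasing_steadily Phi (Derive Phi) T1 (- h / rm)
           (- V - mu * zmax)).
  - apply Rdiv_lt_0_compat; [lra|].
    apply Rlt_le_trans with (rho T1); [apply Hrho | apply Hrm]; unfold T1; lra.
  - intros t Ht. apply Derive_correct. unfold Phi.
    assert (Ht' : T < t) by (unfold T1 in Ht; lra).
    destruct (Hrho t Ht') as [H1 _].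
    auto_derive. repeat split; try (apply Rgt_not_eq; lra).
    + eexists; apply HdD, Ht'.
    + eexists; apply Hdrho, Ht'.
    + eexists; apply HdG', Ht'.
    + eexists; apply Hdrho, Ht'.
    + eexists; apply Hdz, Ht'.
  - intros t Ht. assert (Ht' : T < t) by (unfold T1 in Ht; lra).
    destruct (Hrho t Ht') as [H1 [H2 _]].
    destruct (HdG' t Ht') as [HG1 HG2].
    assert (E : is_derive Phi t (h / rho t + k t / (2 * rho t)
               + lam * (Derive G t / rho t - D t / (2 * rho t) * G t / (2 * I t))
               - mu * (w t * G t))).
    { unfold Phi. auto_derive.
      - repeat split; try (apply Rgt_not_eq; lra).
        + eexists; apply HdD, Ht'.
        + eexists; apply Hdrho, Ht'.
        + eexists; apply HdG', Ht'.
        + eexists; apply Hdrho, Ht'.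
        + eexists; apply Hdz, Ht'.
      - rewrite (Derive_eta _ _ _ (HdD t Ht')),
          (Derive_eta _ _ _ (Hdrho t Ht')),
          (Derive_eta _ _ _ (Hdz t Ht')), (Derive_eta _ _ _ HG1).
        unfold k. rewrite <- H2. field. lra. }
    rewrite (is_derive_unique _ _ _ E).
    assert (Hv1 := Hv t ltac:(lra)). apply Rabs_le_between in Hv1.
    specialize (Hz0 t ltac:(lra)). specialize (HG t Ht'). specialize (Hk t Ht').
    specialize (Hw t Ht'). destruct (HI t Ht') as [Hp _].
    assert (P1 : lam * (Derive G t / rho t) <= - (k t / (2 * rho t))).
    { assert (Derive G t <= - c * k t * z0).
      { apply Rle_trans with (1 := HG2). assert (0 <= c * k t) by nra. nra. }
      replace (- (k t / (2 * rho t))) with (lam * ((- c * k t * z0) / rho t))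
        by (unfold lam; field; lra).
      apply Rmult_le_compat_l; [lra|]. apply Rmult_le_compat_r; [|lra].
      apply Rlt_le, Rinv_0_lt_compat, H1. }
    assert (P2 : - lam * (D t / (2 * rho t) * G t / (2 * I t)) <= mu * (w t * G t)).
    { set (v := D t / (2 * rho t)) in *.
      replace (- lam * (v * G t / (2 * I t))) with (lam * G t / I t * (- v / 2))
        by (field; lra).
      replace (mu * (w t * G t)) with (lam * G t / I t * (V * (w t * I t / wl)))
        by (unfold mu; field; lra).
      apply Rmult_le_compat_l; [apply Rdiv_le_0_compat; nra|].
      assert (1 <= w t * I t / wl).
      { apply Rmult_le_reg_r with wl; [lra|].
        unfold Rdiv. rewrite Rmult_assoc, Rinv_l; lra. }
      nra. }
    assert (P3 : h / rho t <= - (- h / rm)).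
    { specialize (Hrm t Ht').
      assert (/ rm <= / rho t) by (apply Rinv_le_contravar; lra).
      unfold Rdiv. nra. }
    lra.
  - intros t Ht. assert (Ht' : T < t) by (unfold T1 in Ht; lra).
    destruct (Hrho t Ht') as [H1 _].
    assert (Hv1 := Hv t ltac:(lra)). apply Rabs_le_between in Hv1.
    specialize (HG t Ht'). specialize (Hz t Ht').
    assert (0 <= lam * (G t / rho t)).
    { apply Rmult_le_pos; [lra|]. apply Rdiv_le_0_compat; lra. }
    unfold Phi. nra.
Qed.

(** * Planar triangles and the three-body force *)

Definition dot (p q : point) : R := fst p * fst q + snd p * snd q.
Definition enorm (p : point) : R := sqrt (dot p p).
Definition from_to (p q : point) : point := (fst q - fst p, snd q - snd p).
Definition side_combination (k12 k13 k23 : R) (a b : point) : point :=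
  (k12 * fst a + k13 * fst b + k23 * (fst b - fst a),
   k12 * snd a + k13 * snd b + k23 * (snd b - snd a)).

Definition side_sum (w12 w13 w23 : R) (a b a' b' : point) : R :=
  w12 * dot a a' + w13 * dot b b' + w23 * dot (from_to a b) (from_to a' b').

(** A triangle is given by the sides [a], [b] that issue from the first body; the
    third side is [from_to a b].  [size a b a b] is the sum of the squared sides. *)
Definition size (a b a' b' : point) : R := side_sum 1 1 1 a b a' b'.

(** [inertia m a b a b] is the moment of inertia about the center of mass
    (Lagrange's formula), [inertia m u w u w] twice the kinetic energy in the
    center-of-mass frame, and the mixed value half the derivative of the former. *)
Definition inertia (m : body -> R) : point -> point -> point -> point -> R :=
  side_sum (m body1 * m body2 / sum3 m) (m body1 * m body3 / sum3 m)
           (m body2 * m body3 / sum3 m).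

Definition relative_momentum (m : body -> R) (a b u w : point) : R :=
  m body1 * m body2 / sum3 m * wedge a u + m body1 * m body3 / sum3 m * wedge b w
  + m body2 * m body3 / sum3 m * wedge (from_to a b) (from_to u w).

(** The relative accelerations of the sides [a] and [b].  The inverse cubes of the
    sides enter as free coefficients [s12], [s13], [s23], which makes the identities
    below polynomial. *)
Definition pull_a (m : body -> R) (s12 s13 s23 : R) : point -> point -> point :=
  side_combination (- (m body1 + m body2) * s12) (- m body3 * s13) (m body3 * s23).
Definition pull_b (m : body -> R) (s12 s13 s23 : R) : point -> point -> point :=
  side_combination (- m body2 * s12) (- (m body1 + m body3) * s13) (- m body2 * s23).

Ltac coordinates :=
  unfold relative_momentum, inertia, size, side_sum, pull_a, pull_b, side_combination,
    wedge, dot, from_to in *; cbn [fst snd] in *.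

Lemma sum3_pos (m : body -> R) : (forall i, 0 < m i) -> 0 < sum3 m.
Proof.
  intros hm. unfold sum3.
  generalize (hm body1) (hm body2) (hm body3). lra.
Qed.

(** Used twice: with [p, q] the sides it gives the virial identity, with [p, q] the
    side velocities it gives conservation of energy. *)
Lemma inertia_pull (m : body -> R) (s12 s13 s23 : R) (a b p q : point) :
  sum3 m <> 0 ->
  inertia m p q (pull_a m s12 s13 s23 a b) (pull_b m s12 s13 s23 a b) =
  - side_sum (m body1 * m body2 * s12) (m body1 * m body3 * s13)
      (m body2 * m body3 * s23) p q a b.
Proof. intros HM. coordinates. unfold sum3 in *. field. exact HM. Qed.

(** The trace of the linear map that sends the sides to minus their accelerations,
    hence the rate at which this map contracts areas. *)
Definition stiffness (m : body -> R) (s12 s13 s23 : R) : R :=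
  (m body1 + m body2) * s12 + (m body1 + m body3) * s13 + (m body2 + m body3) * s23.

Lemma wedge_pull (m : body -> R) (s12 s13 s23 : R) (a b : point) :
  wedge (pull_a m s12 s13 s23 a b) b + wedge a (pull_b m s12 s13 s23 a b) =
  - stiffness m s12 s13 s23 * wedge a b.
Proof. unfold stiffness. coordinates. ring. Qed.

(** When [s12], [s13], [s23] decrease with the sides, each summand is a product of
    two factors of the same sign. *)
Definition imbalance (m : body -> R) (s12 s13 s23 : R) (a b : point) : R :=
  let A := dot a a in let B := dot b b in let C := dot (from_to a b) (from_to a b) in
  2 * (m body3 * ((C - B) * (s13 - s23)) + m body2 * ((C - A) * (s12 - s23))
       + m body1 * ((B - A) * (s12 - s13))).

(** The choice of the unweighted [size] to normalize the area pays off here: the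
    area has the same [stiffness] term, and what remains has a sign. *)
Lemma size_pull (m : body -> R) (s12 s13 s23 : R) (a b : point) :
  2 * size a b (pull_a m s12 s13 s23 a b) (pull_b m s12 s13 s23 a b) =
  imbalance m s12 s13 s23 a b - stiffness m s12 s13 s23 * size a b a b.
Proof. unfold stiffness, imbalance. coordinates. ring. Qed.

(** The quadratic part in the velocities of [I^2 G'].  On the shape sphere this is
    the geodesic equation for the height function: along a great circle the second
    derivative of the height is minus the height times the squared speed.  For
    unequal masses [size] and [inertia] induce different round metrics on the
    sphere, related by a Moebius map; the factor [I] in the denominator of [G] is
    what makes the conformal correction terms cancel. *)
Lemma shape_kinetic_identity (m : body -> R) (a b u w : point) :
  (forall i, 0 < m i) -> relative_momentum m a b u w = 0 ->
  (2 * wedge u w * size a b a b - 2 * wedge a b * size u w u w) * inertia m a b a b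
  - 2 * (wedge u b + wedge a w) * size a b a b * inertia m a b u w
  + 4 * wedge a b * size a b u w * inertia m a b u w =
  - (4 * (/ m body1 + / m body2 + / m body3)) * wedge a b *
  (inertia m u w u w * inertia m a b a b - inertia m a b u w ^ 2).
Proof.
  intros hm HJ.
  set (c := 4 * (/ m body1 + / m body2 + / m body3)).
  set (L := dot a a * (dot a w + dot b u - dot b w) - 2 * dot a b * (dot a u - dot b w)
            + dot b b * (dot a u - dot a w - dot b u)).
  (* The difference of the two sides is divisible by the momentum; [L] is the part of
     the cofactor that does not come from the rotational kinetic energy. *)
  apply Rminus_diag_uniq.
  transitivity (relative_momentum m a b u w *
    (c * wedge a b * relative_momentum m a b u w - 4 * L)).
  2: rewrite HJ; ring.
  assert (HM := sum3_pos m hm). unfold c, L.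
  generalize (hm body1) (hm body2) (hm body3). intros h1 h2 h3.
  coordinates. unfold sum3 in *. field. lra.
Qed.

Lemma dot_nonneg (p : point) : 0 <= dot p p.
Proof. unfold dot. nra. Qed.

Lemma side_sum_nonneg (w12 w13 w23 : R) (a b : point) :
  0 <= w12 -> 0 <= w13 -> 0 <= w23 -> 0 <= side_sum w12 w13 w23 a b a b.
Proof.
  intros. unfold side_sum. repeat apply Rplus_le_le_0_compat;
    apply Rmult_le_pos; auto using dot_nonneg.
Qed.

Lemma side_sum_le (w12 w13 w23 w12' w13' w23' : R) (a b : point) :
  w12 <= w12' -> w13 <= w13' -> w23 <= w23' ->
  side_sum w12 w13 w23 a b a b <= side_sum w12' w13' w23' a b a b.
Proof.
  intros. unfold side_sum. repeat apply Rplus_le_compat;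
    apply Rmult_le_compat_r; auto using dot_nonneg.
Qed.

(** The left-over form at the velocities minus their radial part [l (a, b)]. *)
Lemma side_sum_cauchy_schwarz (w12 w13 w23 : R) (a b u w : point) :
  0 <= w12 -> 0 <= w13 -> 0 <= w23 -> 0 < side_sum w12 w13 w23 a b a b ->
  0 <= side_sum w12 w13 w23 u w u w
       - side_sum w12 w13 w23 a b u w ^ 2 / side_sum w12 w13 w23 a b a b.
Proof.
  intros h12 h13 h23 HI.
  set (l := side_sum w12 w13 w23 a b u w / side_sum w12 w13 w23 a b a b).
  assert (H := side_sum_nonneg w12 w13 w23 (fst u - l * fst a, snd u - l * snd a)
                 (fst w - l * fst b, snd w - l * snd b) h12 h13 h23).
  apply Rle_trans with (1 := H). apply Req_le.
  transitivity (side_sum w12 w13 w23 u w u w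
    - 2 * l * side_sum w12 w13 w23 a b u w + l ^ 2 * side_sum w12 w13 w23 a b a b).
  - unfold side_sum, dot, from_to; cbn [fst snd]. ring.
  - unfold l. field. lra.
Qed.

Lemma wedge_sq_le (p q : point) : wedge p q ^ 2 <= dot p p * dot q q.
Proof.
  assert (H : dot p p * dot q q - wedge p q ^ 2 = dot p q ^ 2)
    by (unfold dot, wedge; ring).
  assert (0 <= dot p q ^ 2) by nra. lra.
Qed.

Lemma wedge_from_to_l (a b : point) : wedge (from_to a b) b = - wedge a b.
Proof. unfold wedge, from_to; cbn [fst snd]. ring. Qed.

Lemma wedge_from_to_r (a b : point) : wedge a (from_to a b) = wedge a b.
Proof. unfold wedge, from_to; cbn [fst snd]. ring. Qed.

Lemma dot_pos_of_wedge (p q : point) : wedge p q <> 0 -> 0 < dot p p /\ 0 < dot q q.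
Proof.
  intros H. assert (H1 := wedge_sq_le p q). assert (0 < wedge p q ^ 2) by nra.
  generalize (dot_nonneg p) (dot_nonneg q). intros. split; nra.
Qed.

Lemma sides_pos (a b : point) : wedge a b <> 0 ->
  0 < dot a a /\ 0 < dot b b /\ 0 < dot (from_to a b) (from_to a b).
Proof.
  intros H. destruct (dot_pos_of_wedge a b H) as [Ha Hb].
  repeat split; auto. rewrite <- wedge_from_to_r in H.
  apply (dot_pos_of_wedge a _ H).
Qed.

Lemma enorm_pos (p : point) : 0 < dot p p -> 0 < enorm p.
Proof. apply sqrt_lt_R0. Qed.

Lemma enorm_sq (p : point) : enorm p ^ 2 = dot p p.
Proof. apply pow2_sqrt, dot_nonneg. Qed.

Definition inv_cube (p : point) : R := / enorm p ^ 3.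

(** Gravity weakens with distance. *)
Lemma inv_cube_opposes (p q : point) : 0 < dot p p -> 0 < dot q q ->
  0 <= (dot p p - dot q q) * (inv_cube q - inv_cube p).
Proof.
  intros Hp Hq. unfold inv_cube.
  assert (Hmono : forall x y, 0 < dot x x -> dot x x <= dot y y ->
            / enorm y ^ 3 <= / enorm x ^ 3).
  { intros x y Hx Hxy. apply Rinv_le_contravar.
    - apply pow_lt, enorm_pos, Hx.
    - apply pow_incr. split; [apply sqrt_pos|]. apply sqrt_le_1_alt, Hxy. }
  destruct (Rle_lt_dec (dot p p) (dot q q)) as [H|H].
  - specialize (Hmono p q Hp H). nra.
  - specialize (Hmono q p Hq (Rlt_le _ _ H)). nra.
Qed.

Lemma imbalance_nonneg (m : body -> R) (a b : point) :
  (forall i, 0 < m i) -> wedge a b <> 0 ->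
  0 <= imbalance m (inv_cube a) (inv_cube b) (inv_cube (from_to a b)) a b.
Proof.
  intros hm HA. destruct (sides_pos a b HA) as [Ha [Hb Hc]].
  unfold imbalance. apply Rmult_le_pos; [lra|].
  repeat apply Rplus_le_le_0_compat; (apply Rmult_le_pos; [apply Rlt_le, hm|]);
    apply inv_cube_opposes; assumption.
Qed.

Lemma inertia_comparable (m : body -> R) : (forall i, 0 < m i) ->
  exists i0 i1, 0 < i0 /\ 0 < i1 /\ forall a b,
    i0 * size a b a b <= inertia m a b a b <= i1 * size a b a b.
Proof.
  intros hm. assert (HM := sum3_pos m hm).
  assert (Hw : forall i j, 0 < m i * m j / sum3 m).
  { intros i j. apply Rdiv_lt_0_compat; [apply Rmult_lt_0_compat; apply hm | exact HM]. }
  generalize (Hw body1 body2) (Hw body1 body3) (Hw body2 body3). intros h1 h2 h3.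
  unfold inertia.
  set (w12 := m body1 * m body2 / sum3 m) in *.
  set (w13 := m body1 * m body3 / sum3 m) in *.
  set (w23 := m body2 * m body3 / sum3 m) in *.
  exists (Rmin w12 (Rmin w13 w23)), (w12 + w13 + w23).
  split; [repeat apply Rmin_glb_lt; assumption|]. split; [lra|].
  intros a b.
  assert (E : forall l, l * size a b a b = side_sum l l l a b a b)
    by (intros l; unfold size, side_sum; ring).
  rewrite !E. split; apply side_sum_le; try lra.
  - apply Rmin_l.
  - apply Rle_trans with (1 := Rmin_r _ _). apply Rmin_l.
  - apply Rle_trans with (1 := Rmin_r _ _). apply Rmin_r.
Qed.

(** Componentwise differentiability, which the derivative rules for real functions
    can use directly. *)
Definition moves (p v : R -> point) (t : R) : Prop :=
  is_derive (fun s => fst (p s)) t (fst (v t)) /\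
  is_derive (fun s => snd (p s)) t (snd (v t)).

Lemma derive_add (f g : R -> R) (t f' g' : R) :
  is_derive f t f' -> is_derive g t g' -> is_derive (fun s => f s + g s) t (f' + g').
Proof. exact (is_derive_plus f g t f' g'). Qed.

Lemma derive_sub (f g : R -> R) (t f' g' : R) :
  is_derive f t f' -> is_derive g t g' -> is_derive (fun s => f s - g s) t (f' - g').
Proof. exact (is_derive_minus f g t f' g'). Qed.

Lemma derive_mul (f g : R -> R) (t f' g' : R) :
  is_derive f t f' -> is_derive g t g' ->
  is_derive (fun s => f s * g s) t (f' * g t + f t * g').
Proof. intros Hf Hg. exact (is_derive_mult f g t f' g' Hf Hg Rmult_comm). Qed.

Lemma derive_const (k t : R) : is_derive (fun _ : R => k) t 0.
Proof. exact (is_derive_const k t). Qed.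

(* Differentiates a polynomial expression in functions whose derivatives are in the
   context; what is left is the identity between the result and the stated one. *)
Ltac differentiate :=
  evar_last;
  [ repeat match goal with
    | H : is_derive ?f ?t _ |- is_derive ?f ?t _ => exact H
    | |- is_derive (fun s => _ + _) _ _ => apply derive_add
    | |- is_derive (fun s => _ - _) _ _ => apply derive_sub
    | |- is_derive (fun s => _ * _) _ _ => apply derive_mul
    | |- is_derive _ _ _ => apply derive_const
    end
  | cbn beta ].

Lemma moves_wedge (p q u v : R -> point) (t : R) : moves p u t -> moves q v t ->
  is_derive (fun s => wedge (p s) (q s)) t (wedge (u t) (q t) + wedge (p t) (v t)).
Proof.
  intros [H1 H2] [H3 H4]. unfold wedge. differentiate. ring.
Qed.

Lemma moves_dot (p q u v : R -> point) (t : R) : moves p u t -> moves q v t ->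
  is_derive (fun s => dot (p s) (q s)) t (dot (u t) (q t) + dot (p t) (v t)).
Proof.
  intros [H1 H2] [H3 H4]. unfold dot. differentiate. ring.
Qed.

Lemma moves_from_to (p q u v : R -> point) (t : R) : moves p u t -> moves q v t ->
  moves (fun s => from_to (p s) (q s)) (fun s => from_to (u s) (v s)) t.
Proof.
  intros [H1 H2] [H3 H4].
  split; unfold from_to; cbn [fst snd]; differentiate; ring.
Qed.
Lemma moves_side_sum (w12 w13 w23 : R) (a b p q a' b' p' q' : R -> point) (t : R) :
  moves a a' t -> moves b b' t -> moves p p' t -> moves q q' t ->
  is_derive (fun s => side_sum w12 w13 w23 (a s) (b s) (p s) (q s)) t
    (side_sum w12 w13 w23 (a' t) (b' t) (p t) (q t)
     + side_sum w12 w13 w23 (a t) (b t) (p' t) (q' t)).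
Proof.
  intros Ha Hb Hp Hq. unfold side_sum.
  assert (H1 := moves_dot _ _ _ _ _ Ha Hp). assert (H2 := moves_dot _ _ _ _ _ Hb Hq).
  assert (H3 := moves_dot _ _ _ _ _ (moves_from_to _ _ _ _ _ Ha Hb)
                  (moves_from_to _ _ _ _ _ Hp Hq)).
  simpl in H3. differentiate. ring.
Qed.

Lemma derive_inv_sqrt (f : R -> R) (t f' : R) : is_derive f t f' -> 0 < f t ->
  is_derive (fun s => / sqrt (f s)) t (- (f' / (2 * sqrt (f t) ^ 3))).
Proof.
  intros H Hpos. assert (Hs := sqrt_lt_R0 _ Hpos).
  auto_derive.
  - repeat split; auto; [eexists; eassumption | lra].
  - rewrite (Derive_eta _ _ _ H). field. lra.
Qed.

Lemma moves_inv_norm (p v : R -> point) (t : R) : moves p v t -> 0 < dot (p t) (p t) ->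
  is_derive (fun s => / enorm (p s)) t (- (inv_cube (p t) * dot (p t) (v t))).
Proof.
  intros Hp Hpos. assert (Hn := enorm_pos _ Hpos).
  evar_last; [apply derive_inv_sqrt; [exact (moves_dot _ _ _ _ _ Hp Hp) | exact Hpos]|].
  cbn beta. fold (enorm (p t)). unfold inv_cube.
  replace (dot (v t) (p t)) with (dot (p t) (v t)) by (unfold dot; ring).
  field. lra.
Qed.

Definition potential (m : body -> R) (a b : point) : R :=
  m body1 * m body2 / enorm a + m body1 * m body3 / enorm b
  + m body2 * m body3 / enorm (from_to a b).

Lemma moves_potential (m : body -> R) (a b u w : R -> point) (t : R) :
  moves a u t -> moves b w t -> wedge (a t) (b t) <> 0 ->
  is_derive (fun s => potential m (a s) (b s)) t
    (- side_sum (m body1 * m body2 * inv_cube (a t)) (m body1 * m body3 * inv_cube (b t))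
        (m body2 * m body3 * inv_cube (from_to (a t) (b t))) (a t) (b t) (u t) (w t)).
Proof.
  intros Ha Hb HA. destruct (sides_pos _ _ HA) as [Pa [Pb Pc]].
  assert (H1 := moves_inv_norm _ _ _ Ha Pa). assert (H2 := moves_inv_norm _ _ _ Hb Pb).
  assert (H3 := moves_inv_norm _ _ _ (moves_from_to _ _ _ _ _ Ha Hb) Pc).
  simpl in H3. unfold potential, Rdiv, side_sum. differentiate. ring.
Qed.

Lemma side_sum_inv_cube (k12 k13 k23 : R) (a b : point) : wedge a b <> 0 ->
  side_sum (k12 * inv_cube a) (k13 * inv_cube b) (k23 * inv_cube (from_to a b)) a b a b =
  k12 / enorm a + k13 / enorm b + k23 / enorm (from_to a b).
Proof.
  intros HA. destruct (sides_pos _ _ HA) as [Pa [Pb Pc]].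
  unfold side_sum, inv_cube. rewrite <- !enorm_sq.
  apply enorm_pos in Pa, Pb, Pc. field. lra.
Qed.

(** * Nondegenerate motions of a triangle with zero angular momentum *)

Definition gravity_a (m : body -> R) (a b : point) : point :=
  pull_a m (inv_cube a) (inv_cube b) (inv_cube (from_to a b)) a b.
Definition gravity_b (m : body -> R) (a b : point) : point :=
  pull_b m (inv_cube a) (inv_cube b) (inv_cube (from_to a b)) a b.

Record triangle_motion (m : body -> R) (T : R) (a b u w : R -> point) : Prop := {
  moves_a : forall t, T < t -> moves a u t;
  moves_b : forall t, T < t -> moves b w t;
  moves_u : forall t, T < t -> moves u (fun s => gravity_a m (a s) (b s)) t;
  moves_w : forall t, T < t -> moves w (fun s => gravity_b m (a s) (b s)) t;
  momentum_zero : forall t, T < t -> relative_momentum m (a t) (b t) (u t) (w t) = 0;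
  nondegenerate : forall t, T < t -> wedge (a t) (b t) <> 0
}.

Lemma side_sum_sym (w12 w13 w23 : R) (a b p q : point) :
  side_sum w12 w13 w23 a b p q = side_sum w12 w13 w23 p q a b.
Proof. unfold side_sum, dot. ring. Qed.

Lemma size_pos (a b : point) : wedge a b <> 0 -> 0 < size a b a b.
Proof.
  intros H. destruct (sides_pos a b H) as [H1 [H2 H3]]. unfold size, side_sum. lra.
Qed.

Lemma inertia_pos (m : body -> R) (a b : point) :
  (forall i, 0 < m i) -> wedge a b <> 0 -> 0 < inertia m a b a b.
Proof.
  intros hm H. destruct (inertia_comparable m hm) as [i0 [i1 [H0 [_ H1]]]].
  specialize (H1 a b). assert (H2 := size_pos a b H). nra.
Qed.

(** The derivative of the shape variable [wedge a b / size a b a b], weighted by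
    [size^2 / inertia]; with this weight its own derivative has a sign when the
    angular momentum is zero. *)
Definition flux (m : body -> R) (a b u w : point) : R :=
  ((wedge u b + wedge a w) * size a b a b - wedge a b * (2 * size a b u w))
  / inertia m a b a b.

(** Twice the kinetic energy minus twice that of the homothetic motion.  At zero
    angular momentum there is no rotation to subtract. *)
Definition shape_energy (m : body -> R) (a b u w : point) : R :=
  inertia m u w u w - inertia m a b u w ^ 2 / inertia m a b a b.

Lemma derive_quotient (f g : R -> R) (t f' g' : R) : g t <> 0 ->
  is_derive f t f' -> is_derive g t g' ->
  is_derive (fun s => f s / g s) t ((f' * g t - f t * g') / g t ^ 2).
Proof.
  intros Hg Hf Hg'. exact (is_derive_div f g t f' g' Hf Hg' Hg).
Qed.

Section Motion.
Variables (m : body -> R) (T : R) (a b u w : R -> point).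
Hypothesis hm : forall i, 0 < m i.
Hypothesis hmotion : triangle_motion m T a b u w.

Lemma derive_square_sum (w12 w13 w23 t : R) : T < t ->
  is_derive (fun s => side_sum w12 w13 w23 (a s) (b s) (a s) (b s)) t
    (2 * side_sum w12 w13 w23 (a t) (b t) (u t) (w t)).
Proof.
  intros Ht. destruct hmotion as [Ha Hb _ _ _ _].
  evar_last; [apply moves_side_sum; auto|].
  rewrite (side_sum_sym _ _ _ (u t)). ring.
Qed.

Lemma derive_mixed_sum (w12 w13 w23 t : R) : T < t ->
  is_derive (fun s => side_sum w12 w13 w23 (a s) (b s) (u s) (w s)) t
    (side_sum w12 w13 w23 (u t) (w t) (u t) (w t)
     + side_sum w12 w13 w23 (a t) (b t)
         (gravity_a m (a t) (b t)) (gravity_b m (a t) (b t))).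
Proof.
  intros Ht. destruct hmotion as [Ha Hb Hu Hw _ _].
  apply moves_side_sum with (p' := fun s => gravity_a m (a s) (b s))
    (q' := fun s => gravity_b m (a s) (b s)); auto.
Qed.

Lemma derive_shape (t : R) : T < t ->
  is_derive (fun s => wedge (a s) (b s) / size (a s) (b s) (a s) (b s)) t
    (inertia m (a t) (b t) (a t) (b t) / size (a t) (b t) (a t) (b t) ^ 2
     * flux m (a t) (b t) (u t) (w t)).
Proof.
  intros Ht. destruct hmotion as [Ha Hb _ _ _ HA].
  assert (HI := inertia_pos m _ _ hm (HA t Ht)). assert (HQ := size_pos _ _ (HA t Ht)).
  evar_last.
  - apply derive_quotient; [lra | apply moves_wedge; auto | apply derive_square_sum, Ht].
  - unfold flux. unfold size in *. field. lra.
Qed.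

Lemma derive_flux (t : R) : T < t ->
  is_derive (fun s => flux m (a s) (b s) (u s) (w s)) t
    (- (wedge (a t) (b t) / inertia m (a t) (b t) (a t) (b t)) *
     (4 * (/ m body1 + / m body2 + / m body3) * shape_energy m (a t) (b t) (u t) (w t)
      + imbalance m (inv_cube (a t)) (inv_cube (b t)) (inv_cube (from_to (a t) (b t)))
          (a t) (b t))).
Proof.
  intros Ht. destruct hmotion as [Ha Hb Hu Hw HJ HA].
  assert (HI := inertia_pos m _ _ hm (HA t Ht)).
  assert (H1 := moves_wedge _ _ _ _ _ (Ha t Ht) (Hb t Ht)).
  assert (H2 := moves_wedge _ _ _ _ _ (Hu t Ht) (Hb t Ht)).
  assert (H3 := moves_wedge _ _ _ _ _ (Ha t Ht) (Hw t Ht)).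
  assert (H4 := derive_square_sum 1 1 1 t Ht). assert (H5 := derive_mixed_sum 1 1 1 t Ht).
  evar_last.
  { unfold flux. apply derive_quotient; [lra | | apply derive_square_sum, Ht].
    unfold size. differentiate. reflexivity. }
  fold (inertia m). change (side_sum 1 1 1) with size. unfold gravity_a, gravity_b.
  assert (E1 := shape_kinetic_identity m (a t) (b t) (u t) (w t) hm (HJ t Ht)).
  assert (E2 := wedge_pull m (inv_cube (a t)) (inv_cube (b t))
                  (inv_cube (from_to (a t) (b t))) (a t) (b t)).
  assert (E3 := size_pull m (inv_cube (a t)) (inv_cube (b t))
                  (inv_cube (from_to (a t) (b t))) (a t) (b t)).
  unfold shape_energy.
  (* From here on the claim is an identity between the scalars named below. *)
  set (I := inertia m (a t) (b t) (a t) (b t)) in *.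
  set (i := inertia m (a t) (b t) (u t) (w t)) in *.
  set (P := imbalance _ _ _ _ _ _) in *.
  set (S := stiffness _ _ _ _) in *.
  set (A := wedge (a t) (b t)) in *.
  set (Q := size (a t) (b t) (a t) (b t)) in *.
  set (c := 4 * (/ m body1 + / m body2 + / m body3)) in *.
  set (K := inertia m (u t) (w t) (u t) (w t)) in *.
  transitivity (((2 * wedge (u t) (w t) * Q - 2 * A * size (u t) (w t) (u t) (w t)) * I
    - 2 * (wedge (u t) (b t) + wedge (a t) (w t)) * Q * i
    + 4 * A * size (a t) (b t) (u t) (w t) * i) / I ^ 2 - A * P / I).
  - match type of E2 with ?x + ?y = _ =>
      replace x with (- S * A - y) by lra end.
    match type of E3 with 2 * ?x = _ => replace x with ((P - S * Q) / 2) by lra end.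
    field. lra.
  - rewrite E1. field. lra.
Qed.

Definition energy (t : R) : R :=
  inertia m (u t) (w t) (u t) (w t) / 2 - potential m (a t) (b t).

Lemma derive_energy (t : R) : T < t -> is_derive energy t 0.
Proof.
  intros Ht. destruct hmotion as [Ha Hb Hu Hw _ HA].
  assert (HM := sum3_pos m hm).
  assert (H1 := moves_potential m _ _ _ _ _ (Ha t Ht) (Hb t Ht) (HA t Ht)).
  assert (H2 := moves_side_sum (m body1 * m body2 / sum3 m) (m body1 * m body3 / sum3 m)
           (m body2 * m body3 / sum3 m) _ _ _ _ _ _ _ _ t
           (Hu t Ht) (Hw t Ht) (Hu t Ht) (Hw t Ht)).
  assert (E : forall s, / 2 * inertia m (u s) (w s) (u s) (w s)
     - potential m (a s) (b s) = energy s) by (intros s; unfold energy; field).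
  apply (is_derive_ext _ _ _ _ E).
  unfold inertia at 1. differentiate.
  rewrite (side_sum_sym _ _ _ (gravity_a m (a t) (b t))). fold (inertia m).
  unfold gravity_a, gravity_b. rewrite inertia_pull by lra.
  rewrite (side_sum_sym _ _ _ (u t)). field.
Qed.

Lemma energy_constant (s t : R) : T < s -> T < t -> energy s = energy t.
Proof.
  assert (H : forall s t, T < s -> s <= t -> energy s = energy t).
  { intros s' t' Hs Hst.
    assert (H1 := mean_value_bound energy (fun _ => 0) T 0 derive_energy
                    ltac:(intros; lra) s' t' Hs Hst).
    assert (H2 := mean_value_bound (fun y => - energy y) (fun _ => - 0) T 0
                    ltac:(intros y Hy; apply (is_derive_opp energy), derive_energy, Hy)
                    ltac:(intros; lra) s' t' Hs Hst).
    simpl in H2. lra. }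
  intros Hs Ht. destruct (Rle_lt_dec s t); [|symmetry]; apply H; lra.
Qed.

Lemma area_sign : exists sigma, sigma ^ 2 = 1 /\
  forall t, T < t -> 0 < sigma * wedge (a t) (b t).
Proof.
  destruct hmotion as [Ha Hb _ _ _ HA].
  set (A := fun t => wedge (a t) (b t)).
  assert (HAd : forall t, T < t -> continuity_pt A t).
  { intros t Ht. apply derivable_continuous_pt. eexists.
    apply is_derive_Reals, moves_wedge; auto. }
  assert (Hsame : forall s t, T < s -> T < t -> 0 < A s -> 0 < A t).
  { intros s t Hs Ht Hp. apply Rnot_le_lt. intros Hn.
    assert (Hn' : A t < 0) by (destruct Hn as [Hn|Hn]; [exact Hn|]; now apply HA in Hn).
    destruct (Rlt_le_dec t s) as [Hts|Hst].
    - destruct (Ranalysis5.IVT_interv A t s) as [y [Hy E]]; auto.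
      { intros y Hy. apply HAd. lra. }
      apply (HA y); [lra | exact E].
    - assert (Hst' : s < t) by (destruct Hst as [H|H]; [exact H | subst; lra]).
      destruct (Ranalysis5.IVT_interv (fun y => - A y) s t) as [y [Hy E]]; try lra.
      { intros y Hy. apply continuity_pt_opp, HAd. lra. }
      apply (HA y); [lra |]. unfold A in E. lra. }
  destruct (Rtotal_order 0 (A (T + 1))) as [H|[H|H]].
  - exists 1. split; [ring|]. intros t Ht.
    assert (0 < A t) by (apply (Hsame (T + 1)); auto; lra). unfold A in *. lra.
  - exfalso. apply (HA (T + 1)); [lra | symmetry; exact H].
  - exists (-1). split; [ring|]. intros t Ht.
    destruct (Rtotal_order 0 (A t)) as [H1|[H1|H1]].
    + assert (0 < A (T + 1)) by (apply (Hsame t); auto; lra). lra.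
    + exfalso. apply (HA t); [lra | symmetry; exact H1].
    + unfold A in *. lra.
Qed.

End Motion.

(** If the shape is not nearly collinear, no side is small compared with the
    others: a side times any other is at least the area. *)
Lemma potential_bound (m : body -> R) (z0 : R) : (forall i, 0 < m i) -> 0 < z0 ->
  exists C, forall a b, z0 * size a b a b <= Rabs (wedge a b) -> wedge a b <> 0 ->
  potential m a b * sqrt (inertia m a b a b) <= C.
Proof.
  intros hm Hz. destruct (inertia_comparable m hm) as [i0 [i1 [H0 [H1 HI]]]].
  exists ((m body1 * m body2 + m body1 * m body3 + m body2 * m body3) * (sqrt i1 / z0)).
  intros a b Hab HA.
  assert (HQ := size_pos a b HA). destruct (sides_pos a b HA) as [Pa [Pb Pc]].
  assert (Hs : sqrt (inertia m a b a b) <= sqrt i1 * sqrt (size a b a b)).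
  { rewrite <- sqrt_mult by lra. apply sqrt_le_1_alt, HI. }
  assert (HQ' : 0 < sqrt (size a b a b)) by (apply sqrt_lt_R0, HQ).
  assert (Hi : 0 < sqrt i1) by (apply sqrt_lt_R0, H1).
  assert (Hside : forall p q, 0 < dot p p -> dot q q <= size a b a b ->
            Rabs (wedge a b) = Rabs (wedge p q) ->
            / enorm p * sqrt (inertia m a b a b) <= sqrt i1 / z0).
  { intros p q Hp Hq E. rewrite E in Hab.
    assert (Hn : z0 * sqrt (size a b a b) <= enorm p).
    { unfold enorm. rewrite <- (sqrt_pow2 z0) by lra. rewrite <- sqrt_mult by nra.
      apply sqrt_le_1_alt.
      assert (H2 := wedge_sq_le p q). rewrite <- pow2_abs in H2.
      assert (H3 : (z0 * size a b a b) ^ 2 <= Rabs (wedge p q) ^ 2)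
        by (apply pow_incr; split; [nra | exact Hab]).
      apply Rmult_le_reg_r with (size a b a b); [exact HQ|]. nra. }
    assert (Hnp := enorm_pos p Hp).
    apply Rmult_le_reg_r with (enorm p * z0); [nra|].
    replace (/ enorm p * sqrt (inertia m a b a b) * (enorm p * z0))
      with (z0 * sqrt (inertia m a b a b)) by (field; lra).
    replace (sqrt i1 / z0 * (enorm p * z0)) with (sqrt i1 * enorm p) by (field; lra).
    nra. }
  assert (Hsum : dot a a <= size a b a b /\ dot b b <= size a b a b)
    by (unfold size, side_sum; lra).
  assert (Ha := Hside a b Pa (proj2 Hsum) eq_refl).
  assert (Hb := Hside b a Pb (proj1 Hsum)
           ltac:(rewrite <- Rabs_Ropp; f_equal; unfold wedge; ring)).
  assert (Hc := Hside (from_to a b) b Pc (proj2 Hsum)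
           ltac:(rewrite wedge_from_to_l, Rabs_Ropp; reflexivity)).
  generalize (hm body1) (hm body2) (hm body3). intros h1 h2 h3.
  unfold potential, Rdiv. rewrite !Rmult_plus_distr_r, !Rmult_assoc.
  repeat apply Rplus_le_compat;
    (apply Rmult_le_compat_l; [lra|]; apply Rmult_le_compat_l; [lra|]; assumption).
Qed.

(** The data of the analytic core for a triangle; the sign [sigma] of the area
    reduces a clockwise triangle to a counterclockwise one. *)
Lemma triangle_motion_unbounded (m : body -> R) (T K : R) (a b u w : R -> point) :
  (forall i, 0 < m i) -> triangle_motion m T a b u w ->
  (forall t, T < t -> enorm (a t) <= K /\ enorm (b t) <= K /\
                      enorm (from_to (a t) (b t)) <= K) -> False.
Proof.
  intros hm hmotion HK.
  assert (HA := nondegenerate _ _ _ _ _ _ hmotion).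
  destruct (inertia_comparable m hm) as [i0 [i1 [H0 [H1 HI]]]].
  destruct (area_sign m T a b u w hmotion) as [sigma [Hsq Hsigma]].
  assert (HQ := fun t Ht => size_pos _ _ (HA t Ht)).
  assert (HIp := fun t Ht => inertia_pos m _ _ hm (HA t Ht)).
  set (c := 4 * (/ m body1 + / m body2 + / m body3)).
  assert (Hc : 0 < c).
  { generalize (Rinv_0_lt_compat _ (hm body1)) (Rinv_0_lt_compat _ (hm body2))
      (Rinv_0_lt_compat _ (hm body3)). unfold c. lra. }
  assert (Hsigma_abs : Rabs sigma = 1).
  { rewrite <- pow2_abs in Hsq. generalize (Rabs_pos sigma). nra. }
  set (h := energy m a b u w (T + 1)).
  assert (Hh : forall t, T < t ->
    2 * (h + potential m (a t) (b t)) = inertia m (u t) (w t) (u t) (w t)).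
  { intros t Ht. unfold h.
    rewrite (energy_constant m T a b u w hm hmotion (T + 1) t) by lra.
    unfold energy. field. }
  assert (Hk : forall t, T < t -> 2 * (h + potential m (a t) (b t))
      - (2 * inertia m (a t) (b t) (u t) (w t)) ^ 2 / (4 * inertia m (a t) (b t) (a t) (b t))
      = shape_energy m (a t) (b t) (u t) (w t)).
  { intros t Ht. rewrite Hh by exact Ht. unfold shape_energy. specialize (HIp t Ht).
    field. lra. }
  assert (Hk0 : forall t, T < t -> 0 <= shape_energy m (a t) (b t) (u t) (w t)).
  { intros t Ht. assert (HM := sum3_pos m hm).
    assert (Hw : forall i j, 0 <= m i * m j / sum3 m).
    { intros i j. apply Rdiv_le_0_compat; [|exact HM].
      apply Rlt_le, Rmult_lt_0_compat; apply hm. }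
    apply side_sum_cauchy_schwarz; auto. apply HIp, Ht. }
  apply (no_bounded_shape_rise T h (c / i1) (i0 ^ 2) (i1 * (3 * K ^ 2)) 1
    (m body1 * m body2 / K)
    (fun t => inertia m (a t) (b t) (a t) (b t))
    (fun t => 2 * inertia m (a t) (b t) (u t) (w t))
    (fun t => potential m (a t) (b t))
    (fun t => sigma * (wedge (a t) (b t) / size (a t) (b t) (a t) (b t)))
    (fun t => sigma * flux m (a t) (b t) (u t) (w t))
    (fun t => inertia m (a t) (b t) (a t) (b t) / size (a t) (b t) (a t) (b t) ^ 2)).
  - apply Rdiv_lt_0_compat; assumption.
  - apply pow_lt, H0.
  - apply Rdiv_lt_0_compat; [apply Rmult_lt_0_compat; apply hm|].
    apply Rlt_le_trans with (enorm (a (T + 1))).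
    + apply enorm_pos. apply (sides_pos _ (b (T + 1))), HA. lra.
    + apply HK. lra.
  - intros t Ht. split; [apply HIp, Ht|].
    apply Rle_trans with (1 := proj2 (HI _ _)).
    apply Rmult_le_compat_l; [lra|].
    destruct (HK t Ht) as [K1 [K2 K3]].
    assert (Hle : forall p, enorm p <= K -> dot p p <= K ^ 2).
    { intros p Hp. rewrite <- enorm_sq. apply pow_incr. split; [apply sqrt_pos | exact Hp]. }
    apply Hle in K1, K2, K3. unfold size, side_sum. lra.
  - intros t Ht. destruct (sides_pos _ _ (HA t Ht)) as [Pa [Pb Pc]].
    apply enorm_pos in Pa, Pb, Pc. destruct (HK t Ht) as [K1 _].
    assert (Hw : forall i j r, 0 < r -> 0 < m i * m j / r).
    { intros i j r Hr. apply Rdiv_lt_0_compat; [apply Rmult_lt_0_compat; apply hm|exact Hr]. }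
    unfold potential.
    generalize (Hw body1 body3 _ Pb) (Hw body2 body3 _ Pc). intros G1 G2.
    assert (m body1 * m body2 / K <= m body1 * m body2 / enorm (a t)).
    { apply Rmult_le_compat_l; [apply Rlt_le, Rmult_lt_0_compat; apply hm|].
      apply Rinv_le_contravar; assumption. }
    lra.
  - intros z0 Hz0. destruct (potential_bound m z0 hm Hz0) as [C HC].
    exists C. intros t Ht Hz. apply HC; [|apply HA, Ht].
    specialize (Hsigma t Ht). specialize (HQ t Ht).
    replace (Rabs (wedge (a t) (b t))) with (sigma * wedge (a t) (b t)).
    + apply Rmult_le_compat_r with (r := size (a t) (b t) (a t) (b t)) in Hz; [|lra].
      apply Rle_trans with (1 := Hz). apply Req_le. field. lra.
    + rewrite <- (Rabs_pos_eq (sigma * _)) by lra. rewrite Rabs_mult, Hsigma_abs. ring.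
  - intros t Ht. rewrite Hk by exact Ht. apply Hk0, Ht.
  - intros t Ht. specialize (Hsigma t Ht). specialize (HQ t Ht).
    assert (Hab : Rabs (wedge (a t) (b t)) <= size (a t) (b t) (a t) (b t)).
    { apply Rsqr_incr_0_var; [|lra]. rewrite <- Rsqr_abs, !Rsqr_pow2.
      apply Rle_trans with (1 := wedge_sq_le _ _).
      assert (Da := dot_nonneg (a t)). assert (Db := dot_nonneg (b t)).
      assert (Dc := dot_nonneg (from_to (a t) (b t))).
      unfold size, side_sum. nra. }
    assert (Hy : sigma * wedge (a t) (b t) <= size (a t) (b t) (a t) (b t)).
    { apply Rle_trans with (2 := Hab).
      rewrite <- (Rabs_pos_eq (sigma * _)) by lra. rewrite Rabs_mult, Hsigma_abs. lra. }
    unfold Rdiv. rewrite <- Rmult_assoc. split; [apply Rdiv_lt_0_compat; lra|].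
    apply Rmult_le_reg_r with (size (a t) (b t) (a t) (b t)); [exact HQ|].
    rewrite Rmult_assoc, Rinv_l; lra.
  - intros t Ht. destruct (HI (a t) (b t)) as [HI0 _]. specialize (HQ t Ht).
    set (I := inertia m (a t) (b t) (a t) (b t)) in *.
    set (Q := size (a t) (b t) (a t) (b t)) in *.
    apply Rmult_le_reg_r with (Q ^ 2); [nra|].
    replace (I / Q ^ 2 * I * Q ^ 2) with (I ^ 2) by (field; lra).
    rewrite <- Rpow_mult_distr. apply pow_incr. split; [nra | exact HI0].
  - intros t Ht. apply (derive_square_sum m T a b u w hmotion _ _ _ t Ht).
  - intros t Ht. assert (HM := sum3_pos m hm).
    assert (Hm := derive_mixed_sum m T a b u w hmotion (m body1 * m body2 / sum3 m)
      (m body1 * m body3 / sum3 m) (m body2 * m body3 / sum3 m) t Ht).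
    evar_last; [apply derive_mul; [apply derive_const | exact Hm]|].
    fold (inertia m). rewrite <- Hh by exact Ht.
    unfold gravity_a, gravity_b. rewrite inertia_pull by lra.
    rewrite side_sum_inv_cube by apply HA, Ht. fold (potential m (a t) (b t)). ring.
  - intros t Ht.
    evar_last; [apply derive_mul; [apply derive_const |]|].
    + apply (derive_shape m T a b u w hm hmotion t Ht).
    + cbn beta. ring.
  - intros t Ht. rewrite Hk by exact Ht.
    specialize (Hsigma t Ht). specialize (HQ t Ht). specialize (HIp t Ht).
    specialize (Hk0 t Ht). destruct (HI (a t) (b t)) as [_ HI1].
    assert (HP := imbalance_nonneg m _ _ hm (HA t Ht)).
    eexists. split.
    + apply derive_mul; [apply derive_const |].
      apply (derive_flux m T a b u w hm hmotion t Ht).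
    + cbn beta. fold c.
      set (I := inertia m (a t) (b t) (a t) (b t)) in *.
      set (Q := size (a t) (b t) (a t) (b t)) in *.
      set (k := shape_energy _ _ _ _ _) in *. set (P := imbalance _ _ _ _ _ _) in *.
      set (A := wedge (a t) (b t)) in *.
      replace (- (c / i1) * k * (sigma * (A / Q)))
        with (- (sigma * A * c * k * / (i1 * Q))) by (field; lra).
      replace (0 * flux m (a t) (b t) (u t) (w t) + sigma * (- (A / I) * (c * k + P)))
        with (- (sigma * A * c * k * / I) - sigma * A * P * / I) by (field; lra).
      set (y := sigma * A) in *. clearbody y c k P.
      assert (Hinv : / (i1 * Q) <= / I) by (apply Rinv_le_contravar; assumption).
      assert (0 < / I) by (apply Rinv_0_lt_compat, HIp).
      assert (0 <= y * P * / I) by (repeat apply Rmult_le_pos; lra).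
      assert (y * c * k * / (i1 * Q) <= y * c * k * / I)
        by (apply Rmult_le_compat_l; [repeat apply Rmult_le_pos; lra | exact Hinv]).
      lra.
Qed.

(** * From configurations to triangles *)

Lemma dist_euc_enorm (p q : point) :
  dist_euc (fst p) (snd p) (fst q) (snd q) = enorm (from_to p q).
Proof.
  unfold dist_euc, enorm, dot, from_to, Rsqr; cbn [fst snd]. f_equal. ring.
Qed.

Lemma enorm_from_to_sym (p q : point) : enorm (from_to p q) = enorm (from_to q p).
Proof. unfold enorm, dot, from_to; cbn [fst snd]. f_equal. ring. Qed.

Lemma derive_inv_distance_fst (p q : point) : 0 < dot (from_to p q) (from_to p q) ->
  is_derive (fun y => / enorm (from_to (y, snd p) q)) (fst p)
    (inv_cube (from_to p q) * (fst q - fst p)).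
Proof.
  intros H.
  evar_last.
  - apply (moves_inv_norm (fun y => from_to (y, snd p) q) (fun _ => (-1, 0)) (fst p)).
    + split; unfold from_to; cbn [fst snd]; auto_derive; auto; ring.
    + exact H.
  - destruct p as [p1 p2]. unfold dot; cbn [fst snd from_to]. ring.
Qed.

Lemma derive_inv_distance_snd (p q : point) : 0 < dot (from_to p q) (from_to p q) ->
  is_derive (fun y => / enorm (from_to (fst p, y) q)) (snd p)
    (inv_cube (from_to p q) * (snd q - snd p)).
Proof.
  intros H.
  evar_last.
  - apply (moves_inv_norm (fun y => from_to (fst p, y) q) (fun _ => (0, -1)) (snd p)).
    + split; unfold from_to; cbn [fst snd]; auto_derive; auto; ring.
    + exact H.
  - destruct p as [p1 p2]. unfold dot; cbn [fst snd from_to]. ring.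
Qed.

Definition attraction (p q : point) : point :=
  (inv_cube (from_to p q) * (fst q - fst p), inv_cube (from_to p q) * (snd q - snd p)).

(** One computation for the three bodies: as a function of the position of one body
    the potential consists of a constant and of the pulls of the other two. *)
Lemma grad_two_attractors (f : configuration -> R) (q : configuration) (i : body)
    (c0 c1 c2 : R) (p1 p2 : point) :
  (forall p, f (move q i p) = c0 + c1 * / enorm (from_to p p1) + c2 * / enorm (from_to p p2)) ->
  0 < dot (from_to (q i) p1) (from_to (q i) p1) ->
  0 < dot (from_to (q i) p2) (from_to (q i) p2) ->
  grad f q i = (c1 * fst (attraction (q i) p1) + c2 * fst (attraction (q i) p2),
                c1 * snd (attraction (q i) p1) + c2 * snd (attraction (q i) p2)).
Proof.
  intros E H1 H2. unfold grad. f_equal.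
  - apply is_derive_unique.
    assert (D1 := derive_inv_distance_fst _ _ H1).
    assert (D2 := derive_inv_distance_fst _ _ H2).
    apply is_derive_ext with (1 := fun y => eq_sym (E (y, snd (q i)))).
    differentiate. cbn [attraction fst snd]. ring.
  - apply is_derive_unique.
    assert (D1 := derive_inv_distance_snd _ _ H1).
    assert (D2 := derive_inv_distance_snd _ _ H2).
    apply is_derive_ext with (1 := fun y => eq_sym (E (fst (q i), y))).
    differentiate. cbn [attraction fst snd]. ring.
Qed.

Lemma newton_U_enorm (m : body -> R) (q : configuration) :
  newton_U m q =
  m body1 * m body2 * / enorm (from_to (q body1) (q body2))
  + m body1 * m body3 * / enorm (from_to (q body1) (q body3))
  + m body2 * m body3 * / enorm (from_to (q body2) (q body3)).
Proof. unfold newton_U, mutual_distance. rewrite !dist_euc_enorm. reflexivity. Qed.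

Lemma move_same (q : configuration) (i : body) (p : point) : move q i p i = p.
Proof. unfold move. destruct (body_eq_dec i i); congruence. Qed.

Lemma move_other (q : configuration) (i j : body) (p : point) :
  i <> j -> move q i p j = q j.
Proof. intros H. unfold move. destruct (body_eq_dec i j); congruence. Qed.

Lemma from_to_triangle (p q r : point) : from_to (from_to p q) (from_to p r) = from_to q r.
Proof. unfold from_to; cbn [fst snd]. f_equal; ring. Qed.

Lemma dot_from_to_sym (p q : point) :
  dot (from_to p q) (from_to p q) = dot (from_to q p) (from_to q p).
Proof. unfold dot, from_to; cbn [fst snd]. ring. Qed.

Lemma inv_cube_sym (p q : point) : inv_cube (from_to p q) = inv_cube (from_to q p).
Proof. unfold inv_cube. rewrite enorm_from_to_sym. reflexivity. Qed.

Section Relative.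
Variables (m : body -> R) (x : R -> configuration).
Hypothesis hm : forall i, 0 < m i.

Definition body_velocity (i : body) : R -> point := velocity (fun s => x s i).

Definition relative_position (j : body) (t : R) : point := from_to (x t body1) (x t j).
Definition relative_velocity (j : body) (t : R) : point :=
  from_to (body_velocity body1 t) (body_velocity j t).

Lemma differentiable_moves (c : R -> point) (t : R) :
  differentiable c t -> moves c (velocity c) t.
Proof. intros [H1 H2]. split; apply Derive_correct; assumption. Qed.

Lemma newton_moves (t : R) (i : body) : newton_at m x t ->
  moves (fun s => x s i) (body_velocity i) t /\
  moves (body_velocity i) (velocity (body_velocity i)) t.
Proof.
  intros H. destruct (H i) as [H1 [H2 _]]. split; apply differentiable_moves; assumption.
Qed.

Lemma angular_momentum_relative (t : R) : newton_at m x t ->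
  angular_momentum m x t =
  relative_momentum m (relative_position body2 t) (relative_position body3 t)
    (relative_velocity body2 t) (relative_velocity body3 t).
Proof.
  intros H.
  destruct (newton_moves t body1 H) as [[F1 S1] _].
  destruct (newton_moves t body2 H) as [[F2 S2] _].
  destruct (newton_moves t body3 H) as [[F3 S3] _].
  assert (HM := sum3_pos m hm).
  assert (E : velocity (fun s => center_of_mass m (x s)) t =
              center_of_mass m (fun i => body_velocity i t)).
  { unfold velocity at 1, center_of_mass, sum3 at 1 3 5 7, Rdiv; cbn [fst snd].
    f_equal; apply is_derive_unique; differentiate; unfold sum3; ring. }
  unfold angular_momentum. rewrite E. fold (body_velocity body1).
  unfold relative_momentum, relative_position, relative_velocity, center_of_mass,
    wedge, from_to, minus, plus, opp, sum3 in *; cbn [fst snd prod_plus prod_opp] in *.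
  fold (body_velocity body1) (body_velocity body2) (body_velocity body3).
  simpl. unfold plus, opp; simpl. field. lra.
Qed.

Lemma newton_acceleration (t : R) : newton_at m x t ->
  wedge (relative_position body2 t) (relative_position body3 t) <> 0 ->
  from_to (velocity (body_velocity body1) t) (velocity (body_velocity body2) t) =
    gravity_a m (relative_position body2 t) (relative_position body3 t) /\
  from_to (velocity (body_velocity body1) t) (velocity (body_velocity body3) t) =
    gravity_b m (relative_position body2 t) (relative_position body3 t).
Proof.
  intros H HA. destruct (sides_pos _ _ HA) as [P2 [P3 P23]].
  unfold relative_position in *. rewrite from_to_triangle in P23.
  eassert (G1 : grad (newton_U m) (x t) body1 = _).
  { apply (grad_two_attractors _ _ _ (m body2 * m body3 * / enorm (from_to (x t body2) (x t body3)))
      (m body1 * m body2) (m body1 * m body3) (x t body2) (x t body3)); auto.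
    intros p. rewrite newton_U_enorm. rewrite move_same, !move_other by discriminate. ring. }
  eassert (G2 : grad (newton_U m) (x t) body2 = _).
  { apply (grad_two_attractors _ _ _ (m body1 * m body3 * / enorm (from_to (x t body1) (x t body3)))
      (m body1 * m body2) (m body2 * m body3) (x t body1) (x t body3)); auto.
    - intros p. rewrite newton_U_enorm. rewrite move_same, !move_other by discriminate.
      rewrite (enorm_from_to_sym p (x t body1)). ring.
    - rewrite dot_from_to_sym. exact P2. }
  eassert (G3 : grad (newton_U m) (x t) body3 = _).
  { apply (grad_two_attractors _ _ _ (m body1 * m body2 * / enorm (from_to (x t body1) (x t body2)))
      (m body1 * m body3) (m body2 * m body3) (x t body1) (x t body2)); auto.
    - intros p. rewrite newton_U_enorm. rewrite move_same, !move_other by discriminate.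
      rewrite (enorm_from_to_sym p (x t body1)), (enorm_from_to_sym p (x t body2)).
      ring.
    - rewrite dot_from_to_sym. exact P3.
    - rewrite dot_from_to_sym. exact P23. }
  destruct (H body1) as [_ [_ E1]]. destruct (H body2) as [_ [_ E2]].
  destruct (H body3) as [_ [_ E3]].
  rewrite G1 in E1. rewrite G2 in E2. rewrite G3 in E3. clear G1 G2 G3.
  fold (body_velocity body1) in E1. fold (body_velocity body2) in E2.
  fold (body_velocity body3) in E3.
  unfold attraction in *. cbn [fst snd] in *.
  rewrite (inv_cube_sym (x t body2) (x t body1)) in E2.
  rewrite (inv_cube_sym (x t body3) (x t body1)), (inv_cube_sym (x t body3) (x t body2)) in E3.
  unfold gravity_a, gravity_b, pull_a, pull_b, side_combination.
  rewrite from_to_triangle.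
  set (s12 := inv_cube (from_to (x t body1) (x t body2))) in *.
  set (s13 := inv_cube (from_to (x t body1) (x t body3))) in *.
  set (s23 := inv_cube (from_to (x t body2) (x t body3))) in *.
  set (g1 := velocity (body_velocity body1) t) in *.
  set (g2 := velocity (body_velocity body2) t) in *.
  set (g3 := velocity (body_velocity body3) t) in *.
  assert (F : forall (k : R) (g p : point), k <> 0 -> scal k g = p ->
            fst g = fst p / k /\ snd g = snd p / k).
  { intros k g p Hk <-. change (scal k g) with (k * fst g, k * snd g). cbn [fst snd].
    split; field; exact Hk. }
  generalize (hm body1) (hm body2) (hm body3). intros h1 h2 h3.
  apply F in E1; [|lra]. apply F in E2; [|lra]. apply F in E3; [|lra].
  cbn [fst snd] in *. unfold from_to; cbn [fst snd].
  destruct E1 as [-> ->], E2 as [-> ->], E3 as [-> ->].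
  split; f_equal; field; lra.
Qed.

Lemma newton_triangle_motion (T : R) :
  (forall t, T < t -> newton_at m x t) ->
  (forall t, T < t -> angular_momentum m x t = 0) ->
  (forall t, T < t -> wedge (relative_position body2 t) (relative_position body3 t) <> 0) ->
  triangle_motion m T (relative_position body2) (relative_position body3)
    (relative_velocity body2) (relative_velocity body3).
Proof.
  intros HN HJ HA. constructor.
  - intros t Ht. apply moves_from_to; apply newton_moves, HN, Ht.
  - intros t Ht. apply moves_from_to; apply newton_moves, HN, Ht.
  - intros t Ht. destruct (newton_acceleration t (HN t Ht) (HA t Ht)) as [E _].
    unfold moves. rewrite <- E.
    apply moves_from_to; apply newton_moves, HN, Ht.
  - intros t Ht. destruct (newton_acceleration t (HN t Ht) (HA t Ht)) as [_ E].
    unfold moves. rewrite <- E.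
    apply moves_from_to; apply newton_moves, HN, Ht.
  - intros t Ht. rewrite <- angular_momentum_relative by apply HN, Ht. apply HJ, Ht.
  - exact HA.
Qed.

End Relative.

Lemma eclipse_of_wedge (q : configuration) :
  wedge (from_to (q body1) (q body2)) (from_to (q body1) (q body3)) = 0 -> eclipse q.
Proof.
  unfold wedge, from_to; cbn [fst snd]. intros H.
  assert (Hline : forall a b : R, (a, b) <> (0, 0) ->
    a * (fst (q body2) - fst (q body1)) + b * (snd (q body2) - snd (q body1)) = 0 ->
    a * (fst (q body3) - fst (q body1)) + b * (snd (q body3) - snd (q body1)) = 0 ->
    eclipse q).
  { intros a b Hab H2 H3. exists a, b, (a * fst (q body1) + b * snd (q body1)).
    split; [exact Hab|]. intros []; lra. }
  set (a1 := fst (q body2) - fst (q body1)) in *.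
  set (a2 := snd (q body2) - snd (q body1)) in *.
  set (b1 := fst (q body3) - fst (q body1)) in *.
  set (b2 := snd (q body3) - snd (q body1)) in *.
  assert (Hnz : forall r s : R, (r = 0 -> s = 0 -> False) -> (- s, r) <> (0, 0)).
  { intros r s Hrs E. injection E as E1 E2. apply Hrs; lra. }
  (* The normal of the line is orthogonal to a side that does not vanish; if both
     sides at the first body vanish, any normal will do. *)
  destruct (Req_dec a1 0) as [Ha1|Ha1]; [destruct (Req_dec a2 0) as [Ha2|Ha2]|].
  - destruct (Req_dec b1 0) as [Hb1|Hb1]; [destruct (Req_dec b2 0) as [Hb2|Hb2]|].
    + apply (Hline 1 0); [intros E; injection E; lra | nra | nra].
    + apply (Hline (- b2) b1); [apply Hnz; auto | rewrite Ha1, Ha2; ring | ring].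
    + apply (Hline (- b2) b1); [apply Hnz; auto | rewrite Ha1, Ha2; ring | ring].
  - apply (Hline (- a2) a1); [apply Hnz; auto | ring | lra].
  - apply (Hline (- a2) a1); [apply Hnz; auto | ring | lra].
Qed.

Lemma wedge_of_collision (q : configuration) : collision q ->
  wedge (from_to (q body1) (q body2)) (from_to (q body1) (q body3)) = 0.
Proof.
  intros [i [j [Hij E]]]. unfold wedge, from_to; cbn [fst snd].
  destruct i, j; try congruence; rewrite E; ring.
Qed.

Lemma list_upper_bound (l : list R) : exists T, forall t, In t l -> t <= T.
Proof.
  induction l as [|y l [T HT]].
  - exists 0. intros t [].
  - exists (Rmax y T). intros t [<-|Ht]; [apply Rmax_l|].
    apply Rle_trans with T; [apply HT, Ht | apply Rmax_r].
Qed.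

Theorem theorem1 (m : body -> R) (x : R -> configuration)
  (hm : forall i, 0 < m i)
  (hsol : solution_without_triple_collision m x)
  (hJ : zero_angular_momentum m x)
  (hbdd : bounded_motion x) :
  infinite_set (fun t => eclipse (x t)).
Proof.
  intros [l Hl]. destruct (list_upper_bound l) as [T HT]. destruct hbdd as [K HK].
  assert (HA : forall t, T < t ->
            wedge (relative_position x body2 t) (relative_position x body3 t) <> 0).
  { intros t Ht E. apply eclipse_of_wedge, Hl, HT in E. lra. }
  assert (HC : forall t, T < t -> ~ collision (x t)).
  { intros t Ht Hcol. exact (HA t Ht (wedge_of_collision _ Hcol)). }
  apply (triangle_motion_unbounded m T K _ _ _ _ hm
    (newton_triangle_motion m x hm T
       (fun t Ht => sol_newton m x hsol t (HC t Ht)) (fun t Ht => hJ t (HC t Ht)) HA)).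
  intros t _. unfold relative_position. rewrite from_to_triangle, <- !dist_euc_enorm.
  repeat split; apply HK.
Qed.
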